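(* Let $A$ be a finite non-empty alphabet. If $s\in A^\omega$ is overlap-free, then $s\in\mathcal P$.
   Context: $A^\omega$ is the set of one-sided infinite words over $A$. The word $s\in A^\omega$ is overlap-free if it has no factor of the form $vva$, where $v$ is a non-empty finite word and $a$ is the first letter of $v$. $\mathrm{Fact}^+s$ is the set of non-empty finite factors (contiguous blocks) of $s$. A factorization of $s$ is an expression $s=U_1U_2U_3\cdots$ with all $U_i$ non-empty finite words. $\mathcal P$ is the class of infinite words $s$ over finite alphabets for which there exist a finite set $C$ and a map (coloring) $c:\mathrm{Fact}^+s\to C$ such that for each factorization $s=U_1U_2U_3\cdots$ there exist $i,j\ge1$ with $c(U_i)\ne c(U_j)$. *)

(* Defs.v *)
From mathcomp Require Import all_boot.

Set Implicit Arguments.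
Unset Strict Implicit.
Unset Printing Implicit Defensive.

(* Infinite words over A are functions nat -> A, indexed from 0. *)

Section Words.
Variable A : Type.
Implicit Types (s : nat -> A) (w : seq A) (U : nat -> seq A).

(* The block s_i s_(i+1) ... s_(i+n-1). *)
Definition block s (i n : nat) : seq A := mkseq (fun k => s (i + k)) n.

Definition factor s w : Prop := exists i n, w = block s i n.

Definition nonempty_factor s w : Prop := w <> [::] /\ factor s w.

(* Fact^+ s *)
Definition Factp s : Type := {w : seq A | nonempty_factor s w}.

(* In v v a, the non-empty word v is written a :: u. *)
Definition overlap_free s : Prop :=
  forall (a : A) (u : seq A), ~ factor s ((a :: u) ++ (a :: u) ++ [:: a]).

(* s = U 0 U 1 U 2 ...: every finite product U 0 ... U (n-1) is a prefix of s;
   as the U i are non-empty, these prefixes exhaust s. *)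
Definition factorization s U : Prop :=
  (forall i, U i <> [::]) /\
  (forall n, flatten (mkseq U n) = block s 0 (size (flatten (mkseq U n)))).

Lemma factorization_nonempty_factor s U :
  factorization s U -> forall i, nonempty_factor s (U i).
Proof.
move=> [Une Upre] i; split; first exact: Une.
set m := size (flatten (mkseq U i)).
exists m, (size (U i)).
have := Upre i.+1.
rewrite /mkseq -addn1 iotaD map_cat flatten_cat /= cats0 size_cat -/m.
move=> /(congr1 (drop m)).
rewrite drop_size_cat // /block /mkseq iotaD map_cat drop_size_cat; last first.
  by rewrite size_map size_iota.
by move=> ->; rewrite !size_map !size_iota [0 + m]addnC iotaDl -map_comp.
Qed.

Definition factorization_block s U (sU : factorization s U) (i : nat) : Factp s :=
  exist _ (U i) (factorization_nonempty_factor sU i).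

End Words.

(* The class P of words having a finite coloring of their non-empty factors
   for which no factorization is monochromatic. *)
Definition in_class_P (A : finType) (s : nat -> A) : Prop :=
  exists (C : finType) (c : Factp s -> C),
    forall (U : nat -> seq A) (sU : factorization s U),
      exists i j : nat,
        c (factorization_block sU i) <> c (factorization_block sU j).

(* Main.v *)
Require Import Defs.
From mathcomp Require Import all_boot.
From Stdlib Require Import Classical.

(* Colour a non-empty word w by whether w is a prefix of s and whether the
   letter s_|w| equals a = s_0.  In a monochromatic factorization U_0 U_1 ...
   every U_i has the colour of the prefix U_0, hence is a prefix of s; so U_1
   starts with a, which gives s_|U_0| = a.  Thus every U_i a is a prefix of s.
   Lengths cannot decrease forever, so |U_i| <= |U_(i+1)| for some i; then
   U_i a is a prefix of U_(i+1) a, itself a prefix of U_(i+1) U_(i+2), and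
   U_i U_i a is an overlap in s. *)

Section Blocks.
Context {A : Type} (s : nat -> A).

Lemma size_block i n : size (block s i n) = n.
Proof. exact: size_mkseq. Qed.

Lemma blockD i m n : block s i (m + n) = block s i m ++ block s (i + m) n.
Proof.
rewrite /block /mkseq iotaD map_cat [0 + m]addnC iotaDl -map_comp.
by congr (_ ++ _); apply: eq_map => k /=; rewrite addnA.
Qed.

Lemma block_cat i n u v :
  block s i n = u ++ v ->
  u = block s i (size u) /\ v = block s (i + size u) (size v).
Proof.
move=> e; have := congr1 size e; rewrite size_block size_cat => en.
move: e; rewrite en blockD => e.
split.
  by move/(congr1 (take (size u))): e; rewrite !take_size_cat ?size_block.
by move/(congr1 (drop (size u))): e; rewrite !drop_size_cat ?size_block.
Qed.

Lemma factor_infix p w q : factor s (p ++ w ++ q) -> factor s w.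
Proof.
case=> i [n /esym /block_cat [_ /esym /block_cat [-> _]]].
by exists (i + size p), (size w).
Qed.

Lemma block0_cons w : w <> [::] -> w = block s 0 (size w) ->
  exists w', w = s 0 :: w'.
Proof. by case: w => // x w _ [-> _]; exists w. Qed.

(** The third block matters when [U n] and [U n.+1] have equal length: the last letter of the
    overlap then comes from [U n.+2]. *)
Lemma factorization_factor3 U n : factorization s U ->
  factor s (U n ++ U n.+1 ++ U n.+2).
Proof.
case=> _ /(_ n.+3); rewrite /mkseq -addn3 iotaD map_cat flatten_cat /= cats0.
move=> e; apply: (factor_infix (flatten (mkseq U n)) _ [::]).
by rewrite cats0 e; eexists _, _.
Qed.

End Blocks.

Lemma nat_seq_nondecreasing_step (f : nat -> nat) : exists i, f i <= f i.+1.
Proof.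
apply: NNPP => H.
have dec i : f i.+1 < f i.
  by rewrite ltnNge; apply/negP => le_f; apply: H; exists i.
have bound i : f i + i <= f 0.
  elim: i => [|i IHi]; first by rewrite addn0.
  by apply: leq_trans IHi; rewrite addnS -addSn leq_add2r.
(* At [i = f 0 + 1], [bound] would give [f 0 + 1 <= f 0]. *)
by have := leq_trans (leq_addl _ _) (bound (f 0).+1); rewrite ltnn.
Qed.

Definition prefix_color {A : eqType} (s : nat -> A) (w : seq A) : bool * bool :=
  (w == block s 0 (size w), s (size w) == s 0).

Lemma monochromatic_not_overlap_free (A : eqType) (s : nat -> A) U :
  factorization s U ->
  (forall i, prefix_color s (U i) = prefix_color s (U 0)) ->
  ~ overlap_free s.
Proof.
move=> sU mono hs; have [Une Upre] := sU.
have [eU0 eU1] : U 0 = block s 0 (size (U 0)) /\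
    U 1 = block s (size (U 0)) (size (U 1)).
  by have := Upre 2; rewrite /= cats0 => /esym /block_cat.
have prefU i : U i = block s 0 (size (U i)).
  by apply/eqP; case: (mono i) => -> _; apply/eqP.
have headU i : exists w, U i = s 0 :: w by apply: block0_cons.
have nextU i : s (size (U i)) = s 0.
  apply/eqP; case: (mono i) => _ ->; apply/eqP.
  (* [U 1] occurs in [s] at [size (U 0)] and, as a prefix, at 0; compare first letters. *)
  by have [w eU1'] := headU 1; move: eU1; rewrite eU1' => -[-> _]; rewrite addn0.
have extU i : U i ++ [:: s 0] = block s 0 (size (U i)).+1.
  by rewrite -addn1 blockD -prefU /block /mkseq [map _ _]/= addn0 add0n nextU.
have [i le_i] := nat_seq_nondecreasing_step (fun i => size (U i)).
have [v eUi] := headU i; have [w eUi2] := headU i.+2.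
apply: (hs (s 0) v); rewrite -eUi.
have [t et] : exists t, U i.+1 ++ [:: s 0] = (U i ++ [:: s 0]) ++ t.
  (* Both words are prefixes of [s], so [t] is the block of [s] between their ends. *)
  by rewrite !extU -(subnKC (le_i : (size (U i)).+1 <= (size (U i.+1)).+1)) blockD; eexists.
(* [w] is [U i.+2] without its first letter [s 0], which is used to complete [U i.+1 ++
   [:: s 0]]. *)
apply: (factor_infix s [::] _ (t ++ w)).
have := factorization_factor3 s U i sU.
by rewrite eUi2 -cat1s [U i.+1 ++ _]catA et -!catA.
Qed.

Theorem corollary3p12 (A : finType) (hA : 0 < #|A|) (s : nat -> A)
  (hs : overlap_free s) : in_class_P s.
Proof.
exists (bool * bool)%type, (fun w => prefix_color s (sval w)) => U sU.
apply: NNPP => H; apply: (monochromatic_not_overlap_free A s U sU _ hs) => i.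
by apply: NNPP => ne; apply: H; exists i, 0.
Qed.
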